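(* Let $\mathbb{k}$ be a field, $R=\mathbb{k}[x_1,\dots,x_k]$, and let $\mathcal A=\{\ell_1,\dots,\ell_n\}\subset R$ be a central arrangement of size $n$ (and rank $k$). Let $\mathfrak S=\{S_1,\dots,S_m\}$ be a collection of subsets of $[n]=\{1,\dots,n\}$ of the same size, and let $I_{\mathfrak S}=\langle \ell_{S_1},\dots,\ell_{S_m}\rangle\subset R$. Then the reciprocal plane algebra $\mathcal L_{\mathfrak S}^{-1}=\mathbb{k}\left[\frac{1}{\ell_{S_1^c}},\dots,\frac{1}{\ell_{S_m^c}}\right]$ is isomorphic to the special fiber $\mathcal F(I_{\mathfrak S})$ of the ideal $I_{\mathfrak S}$ as graded $\mathbb{k}$-algebras. In particular, the Orlik-Terao algebra $\mathrm{OT}(\mathcal A)$ is graded isomorphic to the special fiber $\mathcal F(I)$ of the ideal $I=I_{n-1}(\mathcal A)=\langle f_1,\dots,f_n\rangle$ of $(n-1)$-fold products of $\mathcal A$, where $f_i=\prod_{j\neq i}\ell_j$.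
   Context: A central arrangement of size $n$ and rank $k$ is given by $n$ pairwise non-proportional nonzero linear forms $\ell_1,\dots,\ell_n\in R=\mathbb{k}[x_1,\dots,x_k]$ with $\langle \ell_1,\dots,\ell_n\rangle=\mathfrak m:=\langle x_1,\dots,x_k\rangle$ (so $n\ge k$). For $S\subseteq[n]$ put $\ell_S=\prod_{i\in S}\ell_i$, $\ell_\emptyset=1$, and $S^c=[n]\setminus S$. The algebra $\mathcal L_{\mathfrak S}^{-1}$ is the $\mathbb{k}$-subalgebra of the fraction field $\mathbb{k}(x_1,\dots,x_k)$ generated by the elements $1/\ell_{S_j^c}$, which are homogeneous of one and the same degree; its grading is normalized so that these generators have degree $1$. For an ideal $I\subset R$ generated by forms of the same degree, the special fiber is $\mathcal F(I)=R[It]\otimes_R R/\mathfrak m\simeq\bigoplus_{s\ge0}I^s/\mathfrak m I^s$, with $I^s/\mathfrak m I^s$ in degree $s$. Orlik-Terao algebra: let $\mathbb{k}[y_1,\dots,y_n]$ have the standard grading. For a linear dependency $D:\ c_{i_1}\ell_{i_1}+\cdots+c_{i_p}\ell_{i_p}=0$ among $p$ of the linear forms, put $\partial D=\sum_{j=1}^p c_{i_j}\prod_{r\ne j}y_{i_r}$. Let $\partial(\mathcal A)\subset \mathbb{k}[y_1,\dots,y_n]$ be the ideal generated by all $\partial D$; then $\mathrm{OT}(\mathcal A)=\mathbb{k}[y_1,\dots,y_n]/\partial(\mathcal A)$.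
   Formalization: The common size s of the subsets S_j is required to be less than n: if S_1=[n], the generator is 1, so the reciprocal plane algebra is k, while the special fiber of the principal ideal is k[t], and the claim fails. *)

(* Defs.v *)
From HB Require Import structures.
From mathcomp Require Import all_boot all_order all_algebra.
From mathcomp Require Import boolp.
From mathcomp Require Import mpoly.

Set Implicit Arguments.
Unset Strict Implicit.
Unset Printing Implicit Defensive.

Import GRing.Theory.

Local Open Scope ring_scope.
Local Open Scope quotient_scope.

Section QuotientAlgebra.
Variables (K : comNzRingType) (A : comAlgType K) (I : idealr A).

Definition quot_scale (c : K) (x : {ideal_quot I}) : {ideal_quot I} :=
  \pi_{ideal_quot I} (c%:A) * x.

Fact quot_scaleA a b x : quot_scale a (quot_scale b x) = quot_scale (a * b) x.
Proof. by rewrite /quot_scale mulrA -rmorphM -scalerAl mul1r scalerA. Qed.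
Fact quot_scale1 : left_id 1 quot_scale.
Proof. by move=> x; rewrite /quot_scale scale1r rmorph1 mul1r. Qed.
Fact quot_scaleDr : right_distributive quot_scale +%R.
Proof. by move=> c x y; rewrite /quot_scale mulrDr. Qed.
Fact quot_scaleDl x : {morph quot_scale^~ x : a b / a + b}.
Proof. by move=> a b; rewrite /quot_scale scalerDl rmorphD mulrDl. Qed.
HB.instance Definition _ := GRing.Zmodule_isLmodule.Build K {ideal_quot I}
  quot_scaleA quot_scale1 quot_scaleDr quot_scaleDl.

Fact quot_scaleAl (c : K) (x y : {ideal_quot I}) : c *: (x * y) = c *: x * y.
Proof. exact: mulrA. Qed.
HB.instance Definition _ :=
  GRing.Lmodule_isLalgebra.Build K {ideal_quot I} quot_scaleAl.
HB.instance Definition _ :=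
  GRing.Lalgebra_isComAlgebra.Build K {ideal_quot I}.

End QuotientAlgebra.

(* A grading is given by its homogeneous components, as predicates. *)
Definition graded_iso (K : comNzRingType) (A B : comAlgType K)
    (gA : nat -> A -> Prop) (gB : nat -> B -> Prop) : Prop :=
  exists f : {lrmorphism A -> B},
    bijective f /\ forall d x, gA d x <-> gB d (f x).

Section Ideals.
Variable R : comNzRingType.
Implicit Types (P Q I J : R -> Prop) (x : R).

Definition ideal_span P x : Prop :=
  exists l : seq (R * R),
    (forall c, c \in l -> P c.2) /\ x = \sum_(c <- l) c.1 * c.2.

Definition idealM I J : R -> Prop :=
  ideal_span (fun z => exists a b, [/\ I a, J b & z = a * b]).

Fixpoint idealX I (s : nat) : R -> Prop :=
  if s is s'.+1 then idealM I (idealX I s') else fun=> True.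

Lemma ideal_span0 P : ideal_span P 0.
Proof. by exists [::]; rewrite big_nil. Qed.

Lemma ideal_spanD P x y : ideal_span P x -> ideal_span P y -> ideal_span P (x + y).
Proof.
move=> [l1 [h1 ->]] [l2 [h2 ->]]; exists (l1 ++ l2); rewrite big_cat; split=> // c.
by rewrite mem_cat => /orP[/h1|/h2].
Qed.

Lemma ideal_spanMl P a x : ideal_span P x -> ideal_span P (a * x).
Proof.
move=> [l [h ->]]; exists [seq (a * c.1, c.2) | c <- l]; split.
  by move=> _ /mapP[c /h ? ->].
by rewrite big_map mulr_sumr; apply: eq_bigr => c _; rewrite mulrA.
Qed.

Lemma mem_ideal_span P x : P x -> ideal_span P x.
Proof.
move=> Px; exists [:: (1, x)]; split; last by rewrite big_seq1 mul1r.
by move=> c; rewrite inE => /eqP ->.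
Qed.

Lemma ideal_span_min P J :
  J 0 -> (forall x y, J x -> J y -> J (x + y)) ->
  (forall a x, P x -> J (a * x)) -> forall x, ideal_span P x -> J x.
Proof.
move=> J0 JD JM x [l [h ->]]; rewrite big_seq; elim/big_ind: _ => // c cl.
exact/JM/h.
Qed.

Lemma idealX0 I s : idealX I s 0.
Proof. by case: s => //= s; apply: ideal_span0. Qed.

Lemma idealXD I s x y : idealX I s x -> idealX I s y -> idealX I s (x + y).
Proof. by case: s => //= s; apply: ideal_spanD. Qed.

Lemma idealXMl I s a x : idealX I s x -> idealX I s (a * x).
Proof. by case: s => //= s; apply: ideal_spanMl. Qed.

Lemma idealXDn I s t x y :
  idealX I s x -> idealX I t y -> idealX I (s + t) (x * y).
Proof.
elim: s x => [|s IHs] x /= Ix Iy; first exact: idealXMl.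
elim/ideal_span_min: x / Ix => [|x1 x2 h1 h2|a x [u [v [Iu Iv ->]]]].
- by rewrite mul0r; apply: ideal_span0.
- by rewrite mulrDl; apply: ideal_spanD.
- rewrite -mulrA; apply: ideal_spanMl; apply: mem_ideal_span.
  by exists u, (v * y); rewrite mulrA; split=> //; apply: IHs.
Qed.

End Ideals.

Section PolynomialRing.
Variables (K : fieldType) (k : nat).
Local Notation R := {mpoly K[k]}.

Definition maxideal : R -> Prop := ideal_span (fun p => exists i, p = 'X_i).

Lemma maxideal_eval0 (p : R) : maxideal p -> p.@[fun=> 0] = 0.
Proof.
elim/ideal_span_min: p / => [|p q hp hq|a _ [i ->]].
- exact: meval0.
- by rewrite mevalD hp hq addr0.
- by rewrite mevalM mevalXU mulr0.
Qed.

(* The Rees algebra R[It], as a K-subalgebra of R[t]: the coefficient of t^s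
   lies in I^s. *)
Section Rees.
Variable I : R -> Prop.

Definition rees_pred (p : {poly R}) : bool := `[< forall s, idealX I s p`_s >].

Lemma rees_subring_closed : subring_closed rees_pred.
Proof.
split.
- by apply/asboolP => -[|s]; rewrite // coef1; apply: idealX0.
- move=> p q /asboolP hp /asboolP hq; apply/asboolP => s.
  by rewrite coefB -mulN1r; apply: idealXD => //; apply: idealXMl.
- move=> p q /asboolP hp /asboolP hq; apply/asboolP => s.
  rewrite coefM; elim/big_ind: _ => [|x y|i _]; first exact: idealX0.
    exact: idealXD.
  have := idealXDn (hp i) (hq (s - i)%N).
  by rewrite subnKC // -ltnS.
Qed.
HB.instance Definition _ :=
  GRing.isSubringClosed.Build {poly R} rees_pred rees_subring_closed.

Record rees := Rees { rees_val : {poly R}; _ : rees_val \in rees_pred }.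
HB.instance Definition _ := [isSub for rees_val].
HB.instance Definition _ := [Choice of rees by <:].
HB.instance Definition _ := [SubChoice_isSubComNzRing of rees by <:].

Fact rees_scale_subproof (c : K) (x : rees) : c%:MP *: rees_val x \in rees_pred.
Proof.
have /asboolP h := valP x.
by apply/asboolP => s; rewrite coefZ; apply: idealXMl.
Qed.
Definition rees_scale (c : K) (x : rees) : rees := Rees (rees_scale_subproof c x).

Fact rees_scaleA a b x : rees_scale a (rees_scale b x) = rees_scale (a * b) x.
Proof. by apply: val_inj; rewrite /= scalerA mpolyCM. Qed.
Fact rees_scale1 : left_id 1 rees_scale.
Proof. by move=> x; apply: val_inj; rewrite /= scale1r. Qed.
Fact rees_scaleDr : right_distributive rees_scale +%R.
Proof. by move=> c x y; apply: val_inj; rewrite /= scalerDr. Qed.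
Fact rees_scaleDl x : {morph rees_scale^~ x : a b / a + b}.
Proof. by move=> a b; apply: val_inj; rewrite /= mpolyCD scalerDl. Qed.
HB.instance Definition _ := GRing.Zmodule_isLmodule.Build K rees
  rees_scaleA rees_scale1 rees_scaleDr rees_scaleDl.

Fact rees_scaleAl (c : K) (x y : rees) : c *: (x * y) = c *: x * y.
Proof. by apply: val_inj; rewrite /= scalerAl. Qed.
HB.instance Definition _ := GRing.Lmodule_isLalgebra.Build K rees rees_scaleAl.
HB.instance Definition _ := GRing.Lalgebra_isComAlgebra.Build K rees.

(* The extension to R[It] of the maximal ideal m of R. *)
Definition fiber_ideal (x : rees) : bool :=
  `[< ideal_span (fun y : rees => exists2 p, maxideal p & val y = p%:P) x >].

Lemma fiber_ideal_closed : idealr_closed fiber_ideal.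
Proof.
split.
- by apply/asboolP; apply: ideal_span0.
- apply/asboolP => h.
  suff: ((rees_val 1)`_0).@[fun=> 0] = 0.
    by move/eqP; rewrite coef1 meval1 oner_eq0.
  elim/ideal_span_min: {1}(1 : rees) / h => [|x y hx hy|a x [p mp /= ->]].
  + by rewrite coef0 meval0.
  + by rewrite coefD mevalD hx hy addr0.
  + by rewrite coefMC mevalM (maxideal_eval0 mp) mulr0.
- move=> a x y /asboolP hx /asboolP hy; apply/asboolP.
  by apply: ideal_spanD => //; apply: ideal_spanMl.
Qed.
HB.instance Definition _ := isIdealr.Build rees fiber_ideal fiber_ideal_closed.

(* R[It] (x)_R R/m is realized as the quotient R[It] / m R[It]. *)
Definition special_fiber : comAlgType K := {ideal_quot (fiber_ideal : idealr rees)}.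

(* I^s / m I^s is the image of I^s t^s. *)
Definition special_fiber_deg (s : nat) (x : special_fiber) : Prop :=
  exists y : rees, (exists p, val y = p *: 'X^s) /\ x = \pi_{ideal_quot (fiber_ideal : idealr rees)} y.

End Rees.

(* The rational function field K(x_1, ..., x_k), as a K-algebra. *)
Definition ratfun : Type := {fraction R}.
HB.instance Definition _ := GRing.Field.on ratfun.

Definition ratfun_scale (c : K) (x : ratfun) : ratfun := tofrac c%:MP * x.
Fact ratfun_scaleA a b x :
  ratfun_scale a (ratfun_scale b x) = ratfun_scale (a * b) x.
Proof. by rewrite /ratfun_scale mulrA mpolyCM rmorphM. Qed.
Fact ratfun_scale1 : left_id 1 ratfun_scale.
Proof. by move=> x; rewrite /ratfun_scale rmorph1 mul1r. Qed.
Fact ratfun_scaleDr : right_distributive ratfun_scale +%R.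
Proof. by move=> c x y; rewrite /ratfun_scale mulrDr. Qed.
Fact ratfun_scaleDl x : {morph ratfun_scale^~ x : a b / a + b}.
Proof. by move=> a b; rewrite /ratfun_scale mpolyCD rmorphD mulrDl. Qed.
HB.instance Definition _ := GRing.Zmodule_isLmodule.Build K ratfun
  ratfun_scaleA ratfun_scale1 ratfun_scaleDr ratfun_scaleDl.
Fact ratfun_scaleAl (c : K) (x y : ratfun) : c *: (x * y) = c *: x * y.
Proof. exact: mulrA. Qed.
HB.instance Definition _ := GRing.Lmodule_isLalgebra.Build K ratfun ratfun_scaleAl.
HB.instance Definition _ := GRing.Lalgebra_isComAlgebra.Build K ratfun.

Definition ratfun_homog (e : int) (x : ratfun) : Prop :=
  exists (f g : R) (d1 d2 : nat),
    [/\ f \is d1.-homog, g \is d2.-homog, g != 0, d1%:Z - d2%:Z = e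
      & x = tofrac f / tofrac g].

(* K[g_1, ..., g_m] inside K(x_1, ..., x_k). *)
Section Subalgebra.
Variables (m : nat) (g : 'I_m -> ratfun).

Definition subalg_pred (x : ratfun) : bool :=
  `[< exists p : {mpoly K[m]}, x = mmap (in_alg ratfun) g p >].

Lemma subalg_pred_closed : subalg_closed subalg_pred.
Proof.
split.
- by apply/asboolP; exists 1; rewrite rmorph1.
- move=> c x y /asboolP[p ->] /asboolP[q ->]; apply/asboolP.
  by exists (c *: p + q); rewrite mmapD mmapZ /= mulr_algl.
- move=> x y /asboolP[p ->] /asboolP[q ->]; apply/asboolP.
  by exists (p * q); rewrite rmorphM.
Qed.
HB.instance Definition _ :=
  GRing.isSubalgClosed.Build K ratfun subalg_pred subalg_pred_closed.

Record subalg := Subalg { subalg_val : ratfun; _ : subalg_val \in subalg_pred }.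
HB.instance Definition _ := [isSub for subalg_val].
HB.instance Definition _ := [Choice of subalg by <:].
HB.instance Definition _ := [SubChoice_isSubAlgebra of subalg by <:].
HB.instance Definition _ := [SubNzRing_isSubComNzRing of subalg by <:].

End Subalgebra.

Record arrangement (n : nat) := Arrangement {
  form :> 'I_n -> R;
  form_homog : forall i, form i \is 1.-homog;
  form_neq0 : forall i, form i != 0;
  form_nonprop : forall i j, i != j -> ~ exists c : K, form i = c *: form j;
  form_span : forall p, ideal_span (fun q => exists i, q = form i) p <-> maxideal p
}.

Section Arrangement.
Variables (n : nat) (A : arrangement n).

Definition form_prod (S : {set 'I_n}) : R := \prod_(i in S) A i.

Definition prod_ideal (m : nat) (S : 'I_m -> {set 'I_n}) : R -> Prop :=
  ideal_span (fun q => exists j, q = form_prod (S j)).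

Definition recip_algebra (m : nat) (S : 'I_m -> {set 'I_n}) : comAlgType K :=
  subalg (fun j => (tofrac (form_prod (~: S j)))^-1).

(* When all the S_j have s < n elements, the generators have degree -(n - s) as
   rational functions; they are given degree 1. *)
Definition recip_algebra_deg (m s : nat) (S : 'I_m -> {set 'I_n}) (d : nat)
    (x : recip_algebra S) : Prop :=
  ratfun_homog (- (d * (n - s))%:Z) (subalg_val x).

(* The boundary of the dependency sum_(i in D) c_i l_i = 0; coefficients c_i
   with i in D may vanish. *)
Definition dep_boundary (D : {set 'I_n}) (c : 'I_n -> K) : {mpoly K[n]} :=
  \sum_(i in D) c i *: \prod_(j in D | j != i) 'X_j.

Definition orlik_terao_ideal (q : {mpoly K[n]}) : bool :=
  `[< ideal_span (fun b => exists (D : {set 'I_n}) (c : 'I_n -> K),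
        \sum_(i in D) c i *: A i = 0 /\ b = dep_boundary D c) q >].

Lemma dep_boundary_eval0 (D : {set 'I_n}) (c : 'I_n -> K) :
  \sum_(i in D) c i *: A i = 0 -> (dep_boundary D c).@[fun=> 0] = 0.
Proof.
move=> dep; rewrite /dep_boundary raddf_sum /=; apply: big1 => i iD.
rewrite mevalZ rmorph_prod /=.
have [j /andP[jD ji] | D1] := pickP (fun j => (j \in D) && (j != i)).
  by rewrite (bigD1 j) ?jD //= mevalXU mul0r mulr0.
have: c i *: A i = 0 by rewrite -[LHS]addr0 -[RHS]dep (bigD1 i) //= [in RHS]big_pred0.
by move/eqP; rewrite scaler_eq0 (negPf (form_neq0 A i)) orbF => /eqP ->; rewrite mul0r.
Qed.

Lemma orlik_terao_ideal_closed : idealr_closed orlik_terao_ideal.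
Proof.
split.
- by apply/asboolP; apply: ideal_span0.
- apply/asboolP => h.
  suff: (1 : {mpoly K[n]}).@[fun=> 0] = 0 by move/eqP; rewrite meval1 oner_eq0.
  elim/ideal_span_min: {1}(1 : {mpoly K[n]}) / h => [|x y hx hy|a x [D [c [dep ->]]]].
  + by rewrite meval0.
  + by rewrite mevalD hx hy addr0.
  + by rewrite mevalM (dep_boundary_eval0 dep) mulr0.
- move=> a x y /asboolP hx /asboolP hy; apply/asboolP.
  by apply: ideal_spanD => //; apply: ideal_spanMl.
Qed.
HB.instance Definition _ :=
  isIdealr.Build {mpoly K[n]} orlik_terao_ideal orlik_terao_ideal_closed.

Definition orlik_terao : comAlgType K := {ideal_quot (orlik_terao_ideal : idealr {mpoly K[n]})}.

Definition orlik_terao_deg (d : nat) (x : orlik_terao) : Prop :=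
  exists q : {mpoly K[n]},
    q \is d.-homog /\ x = \pi_{ideal_quot (orlik_terao_ideal : idealr {mpoly K[n]})} q.

Definition cofactor_ideal : R -> Prop :=
  ideal_span (fun q => exists i, q = \prod_(j | j != i) A j).

End Arrangement.

End PolynomialRing.

(* Main.v *)
Require Import Defs.
From HB Require Import structures.
From mathcomp Require Import all_boot all_order all_algebra.
From mathcomp Require Import boolp mpoly zify.

(** Let [g_1, ..., g_m] be forms of one degree [e].  The graded pieces of the
    special fiber of [I = <g_1, ..., g_m>] are spanned by the products of the
    generators, and [m I^d] vanishes to order more than [d e] at the origin.  So
    the kernel of [K[y] -> F(I)], [y_j |-> g_j t], consists of the [p] all of whose
    homogeneous components vanish at [g].  If [L] is a form of degree larger than
    [e], the degrees of the [p_d(g) / L^d] are distinct, so [y_j |-> g_j / L] has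
    the same kernel.  With [L] the product of all the forms this is the first part.

    For the second part it remains to see that the boundaries of dependencies
    generate the kernel of [y_i |-> 1 / l_i].  This goes by induction on the number
    of nonzero forms.  Fix [l_a <> 0], and let [s] be a linear projection with
    kernel spanned by [l_a].  Modulo the relations, [y_i] is a multiple of [y_a]
    whenever [l_i] is one of [l_a], so an element of the kernel can be written
    [sum_(j <= d) q_j y_a^j] with [q_j] free of these variables.  If [d > 0], multiply
    by [l_a^d] and restrict to the hyperplane [l_a = 0]: [q_d] vanishes at the
    [1 / s l_i], hence is a combination of boundaries of dependencies of the
    [s l_i].  Such a dependency lifts to one of the [l_i] that involves [l_a], which
    rewrites [y_a q_d] as a polynomial free of [y_a], so that [d] can be lowered.  If
    [d = 0], the induction hypothesis applies to the forms not proportional to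
    [l_a]. *)

Set Implicit Arguments.
Unset Strict Implicit.
Unset Printing Implicit Defensive.

Import GRing.Theory.

Local Open Scope ring_scope.
Local Open Scope quotient_scope.

(** * Evaluation morphisms on polynomial rings *)

Lemma mpoly_alg_ind (K : comNzRingType) n (P : {mpoly K[n]} -> Prop) :
  (forall c, P c%:MP) -> (forall i, P 'X_i) ->
  (forall p q, P p -> P q -> P (p + q)) ->
  (forall p q, P p -> P q -> P (p * q)) -> forall p, P p.
Proof.
move=> PC PX PD PM; elim/mpolyind => [|c m p _ _ Pp]; first by rewrite -mpolyC0.
apply/PD => //; rewrite -mul_mpolyC; apply/PM => //.
rewrite mpolyXE_id; elim/big_rec: _ => [|i x _ Px]; first by rewrite -mpolyC1.
apply/PM => //; elim: (m i) => [|e IHe]; first by rewrite expr0 -mpolyC1.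
by rewrite exprS; apply/PM.
Qed.

Lemma mmapXU (K : nzRingType) (S : comNzRingType) n (f : {rmorphism K -> S})
  (h : 'I_n -> S) i : mmap f h 'X_i = h i.
Proof. by rewrite mmapX mmap1U. Qed.

Lemma rmorph_mmap (K : comNzRingType) (S S' : comNzRingType) n
    (f : {rmorphism K -> S}) (h : 'I_n -> S) (f' : {rmorphism K -> S'})
    (g : {rmorphism S -> S'}) p :
  (forall c, g (f c) = f' c) -> g (mmap f h p) = mmap f' (g \o h) p.
Proof.
move=> gf; elim/mpoly_alg_ind: p => [c|i|p q IHp IHq|p q IHp IHq].
- by rewrite !mmapC gf.
- by rewrite !mmapXU.
- by rewrite !rmorphD IHp IHq.
- by rewrite !rmorphM IHp IHq.
Qed.

Lemma eq_mmap (K : comNzRingType) (S : comNzRingType) n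
    (f : {rmorphism K -> S}) (h h' : 'I_n -> S) p :
  h =1 h' -> mmap f h p = mmap f h' p.
Proof. by move=> eqh; apply: eq_bigr => m _; rewrite (mmap1_eq _ eqh). Qed.

Section RationalFunctions.
Variables (K : fieldType) (k : nat).
Local Notation R := {mpoly K[k]}.

(* [tofrac] with codomain [ratfun], whose ring structure Rocq does not identify
   syntactically with that of [{fraction R}]. *)
Definition to_ratfun : R -> ratfun K k := @tofrac _.

Fact to_ratfun_zmod_morphism : zmod_morphism to_ratfun.
Proof. exact: tofrac_is_zmod_morphism. Qed.
HB.instance Definition _ :=
  GRing.isZmodMorphism.Build R (ratfun K k) to_ratfun to_ratfun_zmod_morphism.
Fact to_ratfun_monoid_morphism : monoid_morphism to_ratfun.
Proof. exact: tofrac_is_monoid_morphism. Qed.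
HB.instance Definition _ :=
  GRing.isMonoidMorphism.Build R (ratfun K k) to_ratfun to_ratfun_monoid_morphism.

Lemma to_ratfun_eq0 p : (to_ratfun p == 0) = (p == 0).
Proof. exact: tofrac_eq0. Qed.

Lemma to_ratfun_inj : injective to_ratfun.
Proof. by move=> p q /eqP; rewrite tofrac_eq => /eqP. Qed.

Lemma in_alg_ratfun c : in_alg (ratfun K k) c = to_ratfun c%:MP.
Proof. exact: mulr1. Qed.

Lemma to_ratfunZ c (p : R) : to_ratfun (c *: p) = c *: to_ratfun p.
Proof. by rewrite -mul_mpolyC rmorphM. Qed.

End RationalFunctions.

(** * The kernel of the evaluation at reciprocals of linear forms *)

Section OrlikTeraoRelations.
Variables (K : fieldType) (k n : nat).
Local Notation R := {mpoly K[k]}.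
Local Notation P := {mpoly K[n]}.
Implicit Types (l : 'I_n -> R) (p q : P).

Definition recip_eval l : P -> ratfun K k :=
  mmap (in_alg (ratfun K k)) (fun i => (to_ratfun (l i))^-1).

Fact recip_eval_zmod_morphism l : zmod_morphism (recip_eval l).
Proof. exact: raddfB. Qed.
HB.instance Definition _ l :=
  GRing.isZmodMorphism.Build P (ratfun K k) (recip_eval l) (recip_eval_zmod_morphism l).
Fact recip_eval_monoid_morphism l : monoid_morphism (recip_eval l).
Proof. by split; [exact: rmorph1 | exact: rmorphM]. Qed.
HB.instance Definition _ l :=
  GRing.isMonoidMorphism.Build P (ratfun K k) (recip_eval l) (recip_eval_monoid_morphism l).

(* Forms equal to [0] stand for deleted ones: Rocq's [0^-1 = 0] makes their
   variables vanish under [recip_eval]. *)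
Definition recip_relation l (b : P) : Prop :=
  (exists2 i, l i = 0 & b = 'X_i) \/
  (exists (D : {set 'I_n}) (c : 'I_n -> K),
     [/\ forall i, i \in D -> l i != 0, \sum_(i in D) c i *: l i = 0
       & b = dep_boundary D c]).

Lemma recip_evalZ l c p : recip_eval l (c *: p) = c *: recip_eval l p.
Proof. by rewrite /recip_eval mmapZ mulr_algl. Qed.

Lemma recip_evalXU l i : recip_eval l 'X_i = (to_ratfun (l i))^-1.
Proof. exact: mmapXU. Qed.

(** Omitting the factor at [i] from the product of reciprocals amounts to multiplying the full
    product by [l i]. *)
Lemma recip_eval_dep_boundary l (D : {set 'I_n}) (c : 'I_n -> K) :
  (forall i, i \in D -> l i != 0) ->
  recip_eval l (dep_boundary D c) =
    (\prod_(i in D) (to_ratfun (l i))^-1) * to_ratfun (\sum_(i in D) c i *: l i).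
Proof.
move=> lD; rewrite /dep_boundary !raddf_sum mulr_sumr /=.
apply: eq_bigr => i iD; rewrite recip_evalZ to_ratfunZ -scalerAr; congr (_ *: _).
rewrite [in RHS](bigD1 i) //= mulrAC mulVf ?mul1r ?to_ratfun_eq0 ?lD //.
by rewrite rmorph_prod; apply: eq_bigr => j _; rewrite /= recip_evalXU.
Qed.

Lemma recip_relation_eval0 l p : ideal_span (recip_relation l) p -> recip_eval l p = 0.
Proof.
elim/ideal_span_min: p / => [|p q hp hq|a b].
- exact: rmorph0.
- by rewrite rmorphD /= hp hq addr0.
- rewrite rmorphM /= => -[[i li0 ->]|[D [c [lD dep ->]]]].
    by rewrite recip_evalXU li0 rmorph0 invr0 mulr0.
  by rewrite recip_eval_dep_boundary // dep rmorph0 !mulr0.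
Qed.


Lemma dhomog1E (f : R) : f \is 1.-homog -> f = \sum_i f@_U_(i) *: 'X_i.
Proof.
move=> f1; apply/mpolyP => m; rewrite raddf_sum /=.
have [/eqP|m1] := eqVneq (mdeg m) 1%N; last first.
  rewrite (dhomog_nemf_coeff f1 m1) big1 // => i _.
  by rewrite mcoeffZ mcoeffX; case: (eqVneq U_(i)%MM m) m1 => [<-|]; rewrite ?mdeg1 ?mulr0.
rewrite mdeg_eq1 => /existsP[i /eqP ->].
rewrite (bigD1 i) //= mcoeffZ mcoeffX eqxx mulr1 big1 ?addr0 // => j ji.
by rewrite mcoeffZ mcoeffX eq_mnm1 (negPf ji) mulr0.
Qed.

(** Changing one variable suffices: if [f] has coefficient f_j != 0 at x_j, then x_j |-> x_j - f /
    f_j sends a linear form g to g - (g_j / f_j) f, hence [f] to 0. *)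
Lemma linear_projection (f : R) : f \is 1.-homog -> f != 0 ->
  exists s : {rmorphism R -> R},
    [/\ forall c, s c%:MP = c%:MP, s f = 0
      & forall g, g \is 1.-homog -> exists c, s g = g - c *: f].
Proof.
move=> f1 f0; have [j fj] : exists j, f@_U_(j) != 0.
  apply/existsP; apply: contraNT f0; rewrite negb_exists => /forallP f0.
  by rewrite (dhomog1E f1) big1 // => i _; rewrite (eqP (negPn (f0 i))) scale0r.
pose h i : R := 'X_i - (i == j)%:R * (f@_U_(j))^-1 *: f.
pose s : {rmorphism R -> R} := mmap (@mpolyC k K) h.
have sg g : g \is 1.-homog -> s g = g - (g@_U_(j) / f@_U_(j)) *: f.
  move=> g1; rewrite {1 2}(dhomog1E g1) rmorph_sum /=.
  rewrite (bigD1 j) //= [in RHS](bigD1 j) //= mmapZ mul_mpolyC mmapXU /h eqxx mul1r.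
  rewrite scalerBr scalerA addrAC; congr (_ + _ - _).
  apply: eq_bigr => i /negPf ij.
  by rewrite mmapZ mul_mpolyC mmapXU /h ij mul0r scale0r subr0.
exists s; split=> [c||g /sg ->]; first exact: mmapC.
  by rewrite sg // mulfV // scale1r subrr.
by exists (g@_U_(j) / f@_U_(j)).
Qed.

(** * Specialization of rational functions along a ring endomorphism *)

Section Specialization.
Variable s : {rmorphism R -> R}.

(* [x] is defined at the generic point of the zero locus of [ker s], and [y] is
   its value there. *)
Definition specializes (x y : ratfun K k) : Prop :=
  exists f g, [/\ s g != 0, x = to_ratfun f / to_ratfun g
                & y = to_ratfun (s f) / to_ratfun (s g)].

Lemma specializes_neq0 g : s g != 0 -> g != 0.
Proof. by apply: contraNneq => ->; rewrite rmorph0. Qed.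

Lemma specializes_to_ratfun f : specializes (to_ratfun f) (to_ratfun (s f)).
Proof. by exists f, 1; rewrite !rmorph1 !divr1 oner_eq0. Qed.

Lemma specializesV f : s f != 0 -> specializes (to_ratfun f)^-1 (to_ratfun (s f))^-1.
Proof. by move=> sf; exists 1, f; rewrite !rmorph1 !mul1r. Qed.

Lemma specializesD x y x' y' :
  specializes x x' -> specializes y y' -> specializes (x + y) (x' + y').
Proof.
move=> [f [g [sg -> ->]]] [f' [g' [sg' -> ->]]].
exists (f * g' + f' * g), (g * g').
rewrite !(rmorphD, rmorphM) /= mulf_neq0 //.
by rewrite !addf_div ?to_ratfun_eq0 // specializes_neq0.
Qed.

Lemma specializesM x y x' y' :
  specializes x x' -> specializes y y' -> specializes (x * y) (x' * y').
Proof.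
move=> [f [g [sg -> ->]]] [f' [g' [sg' -> ->]]].
exists (f * f'), (g * g').
by rewrite !mulf_div !rmorphM mulf_neq0.
Qed.

(** Cross-multiplying turns an equality of fractions into a polynomial identity, which [s]
    preserves. *)
Lemma specializes_inj x y y' : specializes x y -> specializes x y' -> y = y'.
Proof.
move=> [f [g [sg -> ->]]] [f' [g' [sg' e ->]]]; apply/eqP.
have sg0 := sg; have sg0' := sg'.
rewrite -to_ratfun_eq0 in sg0; rewrite -to_ratfun_eq0 in sg0'.
have g0 := specializes_neq0 sg; have g0' := specializes_neq0 sg'.
rewrite -to_ratfun_eq0 in g0; rewrite -to_ratfun_eq0 in g0'.
move/eqP: e; rewrite (eqr_div _ _ g0 g0') -!rmorphM.
move=> /eqP/to_ratfun_inj e.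
by rewrite (eqr_div _ _ sg0 sg0') -!rmorphM e.
Qed.

Lemma specializes_mmap (w w' : 'I_n -> ratfun K k) p :
  (forall c, s c%:MP = c%:MP) -> (forall i, specializes (w i) (w' i)) ->
  specializes (mmap (in_alg (ratfun K k)) w p) (mmap (in_alg (ratfun K k)) w' p).
Proof.
move=> sC ww'; elim/mpoly_alg_ind: p => [c|i|p q IHp IHq|p q IHp IHq].
- rewrite !mmapC; have := specializes_to_ratfun c%:MP; rewrite sC -in_alg_ratfun; exact: id.
- by rewrite !mmapXU.
- by rewrite !rmorphD; apply: specializesD.
- by rewrite !rmorphM; apply: specializesM.
Qed.

End Specialization.
End OrlikTeraoRelations.

(** Polynomials congruent to a [good] one modulo the ideal spanned by [Q] are closed under sums and
    products, so a normal form has to be found only for the variables. *)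
Lemma mpoly_congr_ind (K : comNzRingType) n (Q good : {mpoly K[n]} -> Prop) :
  (forall c, good c%:MP) ->
  (forall i, exists2 g, good g & ideal_span Q ('X_i - g)) ->
  (forall p q, good p -> good q -> good (p + q)) ->
  (forall p q, good p -> good q -> good (p * q)) ->
  forall p, exists2 g, good g & ideal_span Q (p - g).
Proof.
move=> goodC goodX goodD goodM.
elim/mpoly_alg_ind => [c|i|p q [g gg hg] [g' gg' hg']|p q [g gg hg] [g' gg' hg']].
- by exists c%:MP => //; rewrite subrr; apply: ideal_span0.
- exact: goodX.
- by exists (g + g'); [apply: goodD | rewrite opprD addrACA; apply: ideal_spanD].
- exists (g * g'); first exact: goodM.
  have -> : p * q - g * g' = q * (p - g) + g * (q - g').
    by rewrite !mulrBr [q * g]mulrC addrA subrK mulrC.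
  by apply: ideal_spanD; apply: ideal_spanMl.
Qed.

Lemma dep_boundary_pair (K : fieldType) n (i j : 'I_n) (c : 'I_n -> K) : i != j ->
  dep_boundary [set i; j] c = c i *: 'X_j + c j *: 'X_i.
Proof.
move=> ij; rewrite /dep_boundary big_setU1 ?inE //= big_set1.
congr (_ *: _ + _ *: _); apply: big_pred1 => m; rewrite !inE.
  by case: (eqVneq m i) => [->|] /=; rewrite ?andbF ?(negPf ij) ?andbT.
by case: (eqVneq m j) => [->|] /=; rewrite ?andbF ?andbT ?orbF // eq_sym (negPf ij).
Qed.

Lemma recip_eval_congr (K : fieldType) k n (l : 'I_n -> {mpoly K[k]}) p q :
  ideal_span (recip_relation l) (p - q) -> recip_eval l p = recip_eval l q.
Proof. by move/recip_relation_eval0/eqP; rewrite rmorphB subr_eq0 => /eqP. Qed.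

(** * The induction step: eliminating the form [l a] *)

Section EliminateForm.
Variables (K : fieldType) (k n : nat).
Local Notation R := {mpoly K[k]}.
Local Notation P := {mpoly K[n]}.
(* [s] restricts linear forms to the hyperplane [l a = 0]. *)
Variables (l : 'I_n -> R) (a : 'I_n) (s : {rmorphism R -> R}).
Hypotheses (l_homog : forall i, l i \is 1.-homog) (la : l a != 0).
Hypotheses (sC : forall c, s c%:MP = c%:MP) (sla : s (l a) = 0).
Hypothesis (sE : forall g, g \is 1.-homog -> exists c, s g = g - c *: l a).

(** The linear forms killed by [s] are exactly the multiples of [l a]. [l'] deletes these forms and
    [X'] their variables, that of [a] included. *)
Let l' i := if s (l i) == 0 then 0 else l i.
Let X' i : P := if s (l i) == 0 then 0 else 'X_i.
Definition drop_vars : P -> P := mmap (@mpolyC n K) X'.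
HB.instance Definition _ := GRing.RMorphism.on drop_vars.

Lemma drop_varsXU i : drop_vars 'X_i = X' i.
Proof. exact: mmapXU. Qed.

Lemma drop_varsZ c p : drop_vars (c *: p) = c *: drop_vars p.
Proof. by rewrite /drop_vars mmapZ mul_mpolyC. Qed.

Lemma drop_vars_prod (D : {pred 'I_n}) :
  (forall i, i \in D -> s (l i) != 0) ->
  drop_vars (\prod_(i in D) 'X_i) = \prod_(i in D) 'X_i.
Proof.
move=> sD; rewrite [LHS]rmorph_prod; apply: eq_bigr => i /sD /negPf li.
by rewrite [LHS]drop_varsXU /X' li.
Qed.

Lemma drop_vars_dep_boundary (D : {set 'I_n}) c :
  (forall i, i \in D -> s (l i) != 0) ->
  drop_vars (dep_boundary D c) = dep_boundary D c.
Proof.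
move=> sD; rewrite [LHS]raddf_sum; apply: eq_bigr => i iD.
rewrite [LHS]drop_varsZ; congr (_ *: _).
by apply: drop_vars_prod => j; rewrite unfold_in => /andP[/sD].
Qed.

(** The normal form sum_j q_j y_a^j. Applying [drop_vars] to the coefficients frees them of the
    deleted variables without a side condition on [Q]. *)
Definition poly_in_var (Q : {poly P}) : P := (map_poly drop_vars Q).['X_a].

Lemma restrictZ c f : s (c *: f) = c *: s f.
Proof. by rewrite -!mul_mpolyC rmorphM /= sC. Qed.

Lemma restrict_eq0 g : g \is 1.-homog -> s g = 0 -> exists c, g = c *: l a.
Proof. by move=> /sE[c ->] /eqP; rewrite subr_eq0 => /eqP ->; exists c. Qed.

(** The forms in a dependency of [l'] are not killed by [s]; on them [l'] agrees with [l], and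
    [drop_vars] fixes the boundary. *)
Lemma relation_drop_vars q :
  ideal_span (recip_relation l') q -> ideal_span (recip_relation l) (drop_vars q).
Proof.
elim/ideal_span_min => [|p1 p2 h1 h2|b _ [[i + ->]|[D [c [lD dep ->]]]]].
- by rewrite rmorph0; apply: ideal_span0.
- by rewrite rmorphD; apply: ideal_spanD.
- have [sli _|sli li] := boolP (s (l i) == 0).
    by rewrite rmorphM /= drop_varsXU /X' sli mulr0; apply: ideal_span0.
  by move: li sli; rewrite /l'; case: ifP => [//|+ li _]; rewrite li rmorph0 eqxx.
have sD i : i \in D -> s (l i) != 0 by move=> /lD; rewrite /l'; case: ifP; rewrite ?eqxx.
rewrite rmorphM /= drop_vars_dep_boundary //; apply/ideal_spanMl/mem_ideal_span; right.
exists D, c; split=> // [i /lD|]; first by rewrite /l'; case: ifP; rewrite ?eqxx.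
rewrite -[RHS]dep; apply: eq_bigr => i /sD /negPf sli.
by rewrite /l' sli.
Qed.

(** If sum_D c_i s(l_i) = 0, then sum_D c_i l_i = e l_a for some e. Adding [a] with coefficient -e
    gives a dependency of [l], whose boundary is y_a times the old one minus e prod_D y_i. *)
Lemma relation_lift q : ideal_span (recip_relation (s \o l)) q ->
  exists r, ideal_span (recip_relation l) ('X_a * drop_vars q - drop_vars r).
Proof.
elim/ideal_span_min => [|p1 p2 [r1 h1] [r2 h2]|b _ [[i /= sli ->]|[D [c [/= sD dep ->]]]]].
- by exists 0; rewrite rmorph0 mulr0 subr0; apply: ideal_span0.
- exists (r1 + r2); rewrite !rmorphD mulrDr opprD addrACA; exact: ideal_spanD.
- exists 0; rewrite rmorph0 subr0 rmorphM /= drop_varsXU /X' sli eqxx !mulr0.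
  exact: ideal_span0.
have [e le] : exists e, \sum_(i in D) c i *: l i = e *: l a.
  apply: restrict_eq0; first by apply: rpred_sum => i _; apply: rpredZ; exact: l_homog.
  by rewrite rmorph_sum /= -[RHS]dep; apply: eq_bigr => i _; rewrite restrictZ.
have aD : a \notin D by apply/negP => /sD; rewrite sla eqxx.
exists (b * (e *: \prod_(i in D) 'X_i)).
rewrite !rmorphM /= drop_varsZ drop_vars_dep_boundary // drop_vars_prod //.
rewrite mulrCA -mulrBr; apply: ideal_spanMl; apply: mem_ideal_span; right.
have neq i : i \in D -> (i == a) = false.
  by move=> iD; apply: contraNF aD => /eqP <-.
exists (a |: D), (fun i => if i == a then - e else c i); split.
- by move=> i; rewrite !inE => /predU1P[->//|/sD]; apply: contraNneq => ->; rewrite rmorph0.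
- rewrite big_setU1 //= eqxx -[X in _ + X = _](_ : e *: l a = _) ?scaleNr ?addNr //.
  by rewrite -le; apply: eq_bigr => i /neq ->.
rewrite /dep_boundary big_setU1 //= eqxx addrC scaleNr; congr (_ - _ *: _).
  rewrite mulr_sumr; apply: eq_bigr => i iD; rewrite neq // -scalerAr; congr (_ *: _).
  rewrite [RHS](bigD1 a) ?inE ?eqxx ?[a == i]eq_sym ?neq //=; congr (_ * _).
  apply: eq_bigl => j; rewrite !inE; case: (eqVneq j a) => [->|]; last by rewrite andbT.
  by rewrite (negPf aD) andbF.
apply: eq_bigl => j; rewrite !inE; case: (eqVneq j a) => [->|]; last by rewrite andbT.
by rewrite (negPf aD).
Qed.

(** Only variables with l_i = c l_a need rewriting. If c != 0 and i != a, the boundary y_a - c y_i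
    of l_i - c l_a = 0 gives y_i = c^-1 y_a; if c = 0, y_i is itself a relation. *)
Lemma mem_poly_in_var p :
  exists Q, ideal_span (recip_relation l) (p - poly_in_var Q).
Proof.
have [||||g [Q ->] hQ] := @mpoly_congr_ind _ _ (recip_relation l)
  (fun g => exists Q, g = poly_in_var Q) _ _ _ _ p; last by exists Q.
- by move=> c; exists c%:MP%:P; rewrite /poly_in_var map_polyC hornerC /= [RHS]mmapC.
- move=> i; suff [Q hQ] : exists Q, ideal_span (recip_relation l) ('X_i - poly_in_var Q).
    by exists (poly_in_var Q) => //; exists Q.
  have [sli|sli] := boolP (s (l i) == 0); last first.
    exists ('X_i)%:P; rewrite /poly_in_var map_polyC hornerC /= drop_varsXU /X'.
    by rewrite (negPf sli) subrr; apply: ideal_span0.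
  have [c lic] := restrict_eq0 (l_homog i) (eqP sli).
  have [c0|c0] := eqVneq c 0.
    exists 0; rewrite /poly_in_var map_poly0 horner0 subr0.
    by apply: mem_ideal_span; left; exists i; rewrite // lic c0 scale0r.
  exists (c^-1%:MP *: 'X); rewrite /poly_in_var map_polyZ map_polyX hornerZ hornerX.
  rewrite /= [drop_vars _]mmapC /=.
  have [ia|ia] := eqVneq i a; last first.
    have -> : 'X_i - c^-1%:MP * 'X_a = (- c^-1)%:MP *
        dep_boundary [set i; a] (fun j => if j == i then 1 else - c).
      rewrite dep_boundary_pair // eqxx [a == i]eq_sym (negPf ia) mulrDr.
      by rewrite !mul_mpolyC scale1r scalerA mulrNN mulVf // scale1r scaleNr addrC.
    apply/ideal_spanMl/mem_ideal_span; right; do 2 eexists; split; last by [].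
      by move=> j; rewrite !inE => /pred2P[]-> //; rewrite lic scaler_eq0 negb_or c0.
    rewrite big_setU1 ?inE //= big_set1 eqxx [a == i]eq_sym (negPf ia) lic.
    by rewrite scale1r scaleNr subrr.
  have /eqP : (1 - c) *: l a = 0 by rewrite scalerBl scale1r -lic ia subrr.
  rewrite scaler_eq0 (negPf la) orbF subr_eq0 => /eqP <-.
  by rewrite ia invr1 mpolyC1 mul1r subrr; apply: ideal_span0.
- move=> _ _ [Q1 ->] [Q2 ->]; exists (Q1 + Q2).
  by rewrite /poly_in_var rmorphD hornerD.
- move=> _ _ [Q1 ->] [Q2 ->]; exists (Q1 * Q2).
  by rewrite /poly_in_var rmorphM hornerM.
Qed.

Lemma recip_eval_drop q :
  recip_eval l (drop_vars q) = recip_eval l' q.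
Proof.
rewrite /recip_eval [LHS](rmorph_mmap _ (f' := in_alg (ratfun K k))); last first.
  by move=> c; rewrite [LHS]mmapC.
apply: eq_mmap => i /=; rewrite /X' /l'; case: ifP => _.
  by rewrite !rmorph0 invr0.
exact: mmapXU.
Qed.

(** Since y_a evaluates to 1 / l_a, the factor l_a^d leaves only denominators that survive
    restriction to l_a = 0. *)
Lemma recip_eval_poly_in_var (Q : {poly P}) d : (size Q <= d.+1)%N ->
  to_ratfun (l a) ^+ d * recip_eval l (poly_in_var Q) =
    \sum_(j < d.+1) recip_eval l' Q`_j * to_ratfun (l a ^+ (d - j)).
Proof.
move=> sQ; rewrite /poly_in_var (@horner_coef_wide _ d.+1); last first.
  exact: leq_trans (size_poly _ _) sQ.
rewrite rmorph_sum mulr_sumr; apply: eq_bigr => j _.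
rewrite rmorphM rmorphXn /= coef_map /= recip_eval_drop recip_evalXU.
rewrite mulrCA rmorphXn /= exprVn; congr (_ * _).
apply: (canLR (mulfK _)); first by rewrite expf_neq0 ?to_ratfun_eq0.
by rewrite -exprD subnK // leq_ord.
Qed.

Lemma lead_coef_recip_eval0 (Q : {poly P}) d : (size Q <= d.+1)%N ->
  recip_eval l (poly_in_var Q) = 0 -> recip_eval (s \o l) Q`_d = 0.
Proof.
move=> sQ Q0; have := recip_eval_poly_in_var sQ; rewrite Q0 mulr0 => e.
(* By uniqueness of specializations it is enough that the expansion [e] of 0 specializes to the
   coefficient. *)
have sp0 : specializes s 0 0.
  rewrite -(rmorph0 (@to_ratfun K k)) -{2}(rmorph0 s).
  exact: specializes_to_ratfun.
have := sp0; rewrite {1}e => sp; apply: (specializes_inj _ sp).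
(* The added terms vanish: for j < d the factor l_a^(d - j) restricts to 0. *)
have -> : recip_eval (s \o l) Q`_d =
    \sum_(j < d.+1) recip_eval (s \o l) Q`_j * to_ratfun (s (l a ^+ (d - j))).
  rewrite big_ord_recr /= subnn !rmorph1 mulr1 big1 ?add0r // => j _.
  by rewrite rmorphXn /= sla expr0n subn_eq0 leqNgt ltn_ord rmorph0 mulr0.
elim/big_ind2: _ => // [*|j _]; first exact: specializesD.
apply: specializesM; last exact: specializes_to_ratfun.
apply: specializes_mmap => // i /=; rewrite /l'; case: ifP => [/eqP ->|/negbT sli].
  by rewrite rmorph0 invr0.
exact: specializesV.
Qed.

Lemma relations_complete_step :
  (forall q, recip_eval l' q = 0 -> ideal_span (recip_relation l') q) ->
  (forall q, recip_eval (s \o l) q = 0 -> ideal_span (recip_relation (s \o l)) q) ->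
  forall p, recip_eval l p = 0 -> ideal_span (recip_relation l) p.
Proof.
move=> IHl' IHs p p0; have [Q hQ] := mem_poly_in_var p.
rewrite -[p](subrK (poly_in_var Q)); apply: ideal_spanD => //.
have: recip_eval l (poly_in_var Q) = 0 by rewrite -(recip_eval_congr hQ).
have [d sQ] : exists d, (size Q <= d.+1)%N by exists (size Q).
elim: d Q sQ {hQ p p0} => [|d IHd] Q sQ Q0.
  rewrite (size1_polyC sQ) /poly_in_var map_polyC hornerC /= in Q0 *.
  by apply/relation_drop_vars/IHl'; rewrite -recip_eval_drop.
have [r hr] := relation_lift (IHs _ (lead_coef_recip_eval0 sQ Q0)).
(* The top term y_a^(d+1) q_(d+1) is traded for y_a^d times [drop_vars r], which lowers the degree
   in y_a. *)
pose Q1 := take_poly d.+1 Q + r%:P * 'X^d.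
have EQ : Q = take_poly d.+1 Q + (Q`_d.+1)%:P * 'X^(d.+1).
  rewrite -{1}[Q](poly_take_drop d.+1); congr (_ + _ * _).
  have sD : (size (drop_poly d.+1 Q) <= 1)%N by rewrite size_drop_poly leq_subLR addn1.
  by rewrite (size1_polyC sD) coef_drop_poly add0n.
have hQQ1 : ideal_span (recip_relation l) (poly_in_var Q - poly_in_var Q1).
  have -> : poly_in_var Q - poly_in_var Q1 =
      'X_a ^+ d * ('X_a * drop_vars Q`_d.+1 - drop_vars r).
    rewrite {1}EQ /poly_in_var !(rmorphD, rmorphM, rmorphXn) /= !map_polyC map_polyX.
    rewrite !hornerE opprD addrACA subrr add0r mulrBr exprS.
    by rewrite mulrA [in RHS]mulrC ['X_a * _]mulrC [X in _ - X]mulrC -mulrA.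
  exact: ideal_spanMl.
rewrite -[poly_in_var Q](subrK (poly_in_var Q1)); apply: ideal_spanD => //.
apply: IHd; last by rewrite -(recip_eval_congr hQQ1).
rewrite (leq_trans (size_polyD _ _)) // geq_max size_take_poly /=.
rewrite (leq_trans (size_polyMleq _ _)) // size_polyXn addnS /=.
by rewrite -add1n leq_add2r size_polyC leq_b1.
Qed.

End EliminateForm.

Lemma recip_relations_complete (K : fieldType) k n (l : 'I_n -> {mpoly K[k]}) :
  (forall i, l i \is 1.-homog) ->
  forall p, recip_eval l p = 0 -> ideal_span (recip_relation l) p.
Proof.
have [N] := ubnP #|[set i | l i != 0]|; elim: N l => // N IHN l ltN l1 p p0.
have [a la|l0] := pickP (fun i => l i != 0); last first.
  (* If all forms are 0, every variable is a relation and [p] is congruent to a constant. *)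
  have [||||_ [c ->] hc] := @mpoly_congr_ind _ _ (recip_relation l)
    (fun g => exists c, g = c%:MP) _ _ _ _ p.
  - by move=> c; exists c.
  - move=> i; exists 0; first by exists 0; rewrite mpolyC0.
    by rewrite subr0; apply: mem_ideal_span; left; exists i => //; apply/eqP/negbFE/l0.
  - by move=> _ _ [c ->] [c' ->]; exists (c + c'); rewrite mpolyCD.
  - by move=> _ _ [c ->] [c' ->]; exists (c * c'); rewrite mpolyCM.
  suff c0 : c = 0 by move: hc; rewrite c0 mpolyC0 subr0.
  move: (recip_eval_congr hc); rewrite p0 [RHS]mmapC => /esym/eqP.
  by rewrite [X in X == _]in_alg_ratfun to_ratfun_eq0 mpolyC_eq0 => /eqP.
have [s [sC sla sE]] := linear_projection (l1 a) la.
have s1 i : s (l i) \is 1.-homog.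
  by have [c ->] := sE _ (l1 i); apply: rpredB => //; apply: rpredZ.
(* This serves both induction hypotheses: the deleted and the restricted family vanish wherever
   [s (l i)] does, in particular at [a]. *)
have cardlt (l' : 'I_n -> {mpoly K[k]}) :
    (forall i, l' i != 0 -> s (l i) != 0) -> (#|[set i | l' i != 0%R]| < N)%N.
  move=> hl'; rewrite ltnS in ltN; apply: leq_trans ltN; apply: proper_card.
  apply/properP; split.
    apply/subsetP => i; rewrite !inE => /hl'.
    by apply: contraNneq => ->; rewrite rmorph0.
  exists a; rewrite !inE //; apply/negP => /hl'; by rewrite sla eqxx.
apply: (relations_complete_step l1 la sC sla sE) => // q; apply: IHN.
- by apply: cardlt => i; case: ifP; rewrite ?eqxx.
- by move=> i; case: ifP => // _; apply: rpred0.
- exact: cardlt.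
- exact: s1.
Qed.

(** * Homogeneous components of relations *)

(** Take a chosen preimage under [f], then apply [g]; equality of the kernels makes the result
    independent of the choice, hence a morphism. *)
Lemma graded_iso_of_presentations (K : comNzRingType) m (A B : comAlgType K)
    (gA : nat -> A -> Prop) (gB : nat -> B -> Prop)
    (f : {rmorphism {mpoly K[m]} -> A}) (g : {rmorphism {mpoly K[m]} -> B}) :
  scalable f -> scalable g ->
  (forall x, exists p, x = f p) -> (forall y, exists p, y = g p) ->
  (forall p, f p = 0 <-> g p = 0) ->
  (forall d x, gA d x <-> exists2 p, p \is d.-homog & x = f p) ->
  (forall d y, gB d y <-> exists2 p, p \is d.-homog & y = g p) ->
  graded_iso gA gB.
Proof.
move=> fZ gZ fS gS ker gAE gBE.
pose u x := projT1 (cid (fS x)); have uK x : f (u x) = x by rewrite -(projT2 (cid (fS x))).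
pose v y := projT1 (cid (gS y)); have vK y : g (v y) = y by rewrite -(projT2 (cid (gS y))).
have fg p q : f p = f q -> g p = g q.
  by move/eqP; rewrite -subr_eq0 -rmorphB => /eqP/ker/eqP; rewrite rmorphB subr_eq0 => /eqP.
have gf p q : g p = g q -> f p = f q.
  by move/eqP; rewrite -subr_eq0 -rmorphB => /eqP/ker/eqP; rewrite rmorphB subr_eq0 => /eqP.
pose F x := g (u x); have FE p : F (f p) = g p by apply: fg; rewrite uK.
have FB : zmod_morphism F.
  by move=> x y; rewrite -[x]uK -[y]uK -rmorphB !FE rmorphB.
have FM : monoid_morphism F.
  split; first by rewrite -(rmorph1 f) FE rmorph1.
  by move=> x y; rewrite -[x]uK -[y]uK -rmorphM !FE rmorphM.
have FZ : scalable F by move=> c x; rewrite -[x]uK -fZ !FE gZ.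
pose F' : {lrmorphism A -> B} := HB.pack F
  (GRing.isZmodMorphism.Build A B F FB) (GRing.isMonoidMorphism.Build A B F FM)
  (GRing.isScalable.Build K A B *:%R F FZ).
exists F'; split=> [|d x].
  exists (f \o v) => [x|y] /=; last by rewrite FE vK.
  by rewrite -[RHS]uK; apply: gf; rewrite vK.
rewrite gAE gBE; split=> [[p pd ->]|[p pd e]]; exists p => //.
by rewrite -[x]uK; apply: gf; rewrite -e.
Qed.

Section HomogeneousSubstitution.
Variables (K : fieldType) (m : nat).
Local Notation P := {mpoly K[m]}.

Lemma mmap_homog_scale (S : comNzRingType) (f : {rmorphism K -> S}) (h : 'I_m -> S)
    (t : S) d (q : P) :
  q \is d.-homog -> mmap f (fun j => h j * t) q = mmap f h q * t ^+ d.
Proof.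
move=> /dhomogP qd; rewrite mulr_suml [LHS]big_seq [RHS]big_seq.
apply: eq_bigr => mm /qd <-; rewrite -mulrA; congr (_ * _).
rewrite /= mdegE -prodrXr -big_split /=; apply: eq_bigr => i _.
by rewrite exprMn.
Qed.

Lemma dhomog_mmap k (g : 'I_m -> {mpoly K[k]}) e d (q : P) :
  (forall j, g j \is e.-homog) -> q \is d.-homog ->
  mmap (@mpolyC k K) g q \is (d * e).-homog.
Proof.
move=> ge /dhomogP qd; rewrite /mmap big_seq; apply: rpred_sum => mm /qd <-.
rewrite mul_mpolyC; apply: rpredZ; rewrite /= mdegE big_distrl /= /mmap1.
elim/big_rec2: _ => [|i a b _ hb]; first exact: dhomog1.
by apply: dhomogM => //; rewrite mulnC; apply: dhomogMn.
Qed.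

Lemma sum_pihomog M (p : P) : (msize p <= M)%N -> p = \sum_(d < M) pihomog mdeg d p.
Proof. exact: pihomog_partitionE. Qed.

End HomogeneousSubstitution.

(** * Recovering homogeneous components from values with powers of a form as denominators *)

Section Dehomogenization.
Variables (K : fieldType) (k m : nat) (g : 'I_m -> {mpoly K[k]}) (L : {mpoly K[k]}).
Variables (e N : nat).
Hypotheses (g_homog : forall j, g j \is e.-homog) (L_homog : L \is N.-homog).
Hypotheses (L_neq0 : L != 0) (lt_eN : (e < N)%N).
Local Notation gev := (mmap (@mpolyC k K) g).
Local Notation ev :=
  (mmap (in_alg (ratfun K k)) (fun j => to_ratfun (g j) * (to_ratfun L)^-1)).

Lemma mmap_quotient_homog d p : p \is d.-homog ->
  ev p = to_ratfun (gev p) / to_ratfun (L ^+ d).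
Proof.
move=> pd; rewrite (mmap_homog_scale _ _ _ pd) exprVn rmorphXn; congr (_ / _).
by rewrite [RHS](rmorph_mmap _ (f' := in_alg (ratfun K k))) // => c; exact/esym/in_alg_ratfun.
Qed.

Lemma ratfun_homog_mmap d p : p \is d.-homog ->
  ratfun_homog (- (d * (N - e))%:Z) (ev p).
Proof.
move=> pd; exists (gev p), (L ^+ d), (d * e)%N, (d * N)%N; split.
- exact: dhomog_mmap.
- by rewrite mulnC; apply: dhomogMn.
- exact: expf_neq0.
- by rewrite mulnBr -subzn ?opprB // leq_mul2l ltnW ?orbT.
- exact: mmap_quotient_homog.
Qed.

Lemma mmap_sum_quotient M p : (msize p <= M)%N ->
  ev p = \sum_(i < M) to_ratfun (gev (pihomog mdeg i p)) / to_ratfun (L ^+ i).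
Proof.
move/sum_pihomog => Ep; rewrite {1}Ep rmorph_sum; apply: eq_bigr => i _.
exact: mmap_quotient_homog (pihomogP _ _ _).
Qed.

Lemma clear_denominators M p f f' : (msize p <= M)%N -> f' != 0 ->
  ev p = to_ratfun f / to_ratfun f' ->
  \sum_(i < M) f' * gev (pihomog mdeg i p) * L ^+ (M - i) = f * L ^+ M.
Proof.
move=> pM f'0 evp; apply: to_ratfun_inj; rewrite rmorph_sum rmorphM /=.
rewrite -[to_ratfun f](divfK (_ : to_ratfun f' != 0)) ?to_ratfun_eq0 // -evp.
rewrite (mmap_sum_quotient pM) !mulr_suml; apply: eq_bigr => i _.
have -> : L ^+ M = L ^+ i * L ^+ (M - i) by rewrite -exprD subnKC // ltnW.
rewrite !rmorphM /= [RHS]mulrA.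
by congr (_ * _); rewrite [RHS]mulrAC divfK ?to_ratfun_eq0 ?expf_neq0 // mulrC.
Qed.

(** The cleared i-th term has degree i e + (M - i) N up to a fixed shift. This equals M N - i (N -
    e), so distinct terms have distinct degrees. *)
Lemma degree_clear_denominators M i : (i <= M)%N ->
  (i * e + (M - i) * N + i * (N - e) = M * N)%N.
Proof. by move=> iM; rewrite addnAC -mulnDr subnKC ?(ltnW lt_eN) // -mulnDl subnKC. Qed.

(** After clearing denominators the right-hand side is homogeneous of the degree belonging to index
    d. Extracting the degree of index j != d leaves a single product equal to 0, with [f'] and [L]
    nonzero. *)
Lemma mmap_pihomog_eq0 d j p : ratfun_homog (- (d * (N - e))%:Z) (ev p) ->
  j != d -> gev (pihomog mdeg j p) = 0.
Proof.
move=> [f [f' [d1 [d2 [fd1 f'd2 f'0 d12 evp]]]]] jd.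
(* The maximum makes [j] an index of the sum even beyond the degree of [p]. *)
pose M := maxn (msize p) j.+1; have jM : (j < M)%N by rewrite leq_max ltnSn orbT.
have term_homog i : f' * gev (pihomog mdeg i p) * L ^+ (M - i)
    \is (d2 + (i * e + (M - i) * N)).-homog.
  rewrite addnA; apply: dhomogM; last by rewrite mulnC; apply: dhomogMn.
  by apply: dhomogM => //; apply: dhomog_mmap => //; apply: pihomogP.
have := clear_denominators (leq_maxl _ j.+1) f'0 evp; rewrite -/M.
move/(congr1 (pihomog mdeg (d2 + (j * e + (M - j) * N)))).
have hj := degree_clear_denominators (ltnW jM).
have Ne : (0 < N - e)%N by rewrite subn_gt0.
have -> : pihomog mdeg (d2 + (j * e + (M - j) * N)) (f * L ^+ M) = 0.
  apply: (@pihomog_ne0 _ _ _ (d1 + N * M)); last by apply: dhomogM => //; apply: dhomogMn.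
  apply: contraNneq jd => E; rewrite -(eqn_pmul2r Ne); lia.
rewrite raddf_sum (bigD1 (Ordinal jM)) //= pihomog_dE // big1 ?addr0; last first.
  move=> i ij; apply: pihomog_ne0 (term_homog i).
  have hi := degree_clear_denominators (ltnW (ltn_ord i)).
  apply: contraNneq ij => E; rewrite -val_eqE /= -(eqn_pmul2r Ne); lia.
by move/eqP; rewrite !mulf_eq0 (negPf f'0) expf_eq0 (negPf L_neq0) andbF orbF /= => /eqP.
Qed.

Lemma mmap_quotient_eq0 p : ev p = 0 <-> forall d, gev (pihomog mdeg d p) = 0.
Proof.
split=> [p0 d|p0]; last first.
  by rewrite (mmap_sum_quotient (leqnn _)) big1 // => i _; rewrite p0 rmorph0 mul0r.
(* Zero is homogeneous of every degree, in particular of one belonging to an index other than d. *)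
apply: (@mmap_pihomog_eq0 d.+1); last by rewrite neq_ltn ltnSn.
rewrite p0 -(rmorph0 (mmap (in_alg (ratfun K k))
  (fun j => to_ratfun (g j) * (to_ratfun L)^-1))).
exact: ratfun_homog_mmap (dhomog0 _ _ _).
Qed.

Lemma ratfun_homog_mmapP d p : ratfun_homog (- (d * (N - e))%:Z) (ev p) ->
  ev p = ev (pihomog mdeg d p).
Proof.
move=> pd; apply/eqP; rewrite -subr_eq0 -rmorphB; apply/eqP/mmap_quotient_eq0 => j.
have [->|jd] := eqVneq j d.
  by rewrite raddfB /= pihomog_id subrr rmorph0.
rewrite raddfB rmorphB /= (mmap_pihomog_eq0 pd jd) sub0r.
by rewrite (@pihomog_ne0 _ _ _ d) ?rmorph0 ?oppr0 ?pihomogP // eq_sym.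
Qed.

End Dehomogenization.

(** * The special fiber *)

Lemma ideal_quot_eq0 (S : comNzRingType) (I : idealr S) (x : S) :
  \pi_{ideal_quot I} x = 0 <-> x \in I.
Proof.
rewrite -(rmorph0 \pi_{ideal_quot I}) -{2}[x]subr0 Quotient.idealrBE.
by split=> [->|/eqP].
Qed.

Lemma ideal_quotZ (K : comNzRingType) (S : comAlgType K) (I : idealr S) (c : K) (x : S) :
  \pi_{ideal_quot I} (c *: x) = c *: \pi_{ideal_quot I} x.
Proof. by rewrite -mulr_algl rmorphM. Qed.

Lemma ideal_quot_surj (S : comNzRingType) (I : idealr S) (x : {ideal_quot I}) :
  exists y, x = \pi_{ideal_quot I} y.
Proof. by exists (repr x); rewrite reprK. Qed.

(** * Order of vanishing at the origin *)

Section Order.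
Variables (K : fieldType) (k : nat).
Local Notation R := {mpoly K[k]}.

Definition vanishes_to_order (d : nat) (p : R) := forall m, (mdeg m < d)%N -> p@_m = 0.

Lemma vanishes_to_order0 d : vanishes_to_order d 0.
Proof. by move=> m _; rewrite mcoeff0. Qed.

Lemma vanishes_to_orderD d p q :
  vanishes_to_order d p -> vanishes_to_order d q -> vanishes_to_order d (p + q).
Proof. by move=> hp hq m md; rewrite mcoeffD hp // hq // addr0. Qed.

Lemma vanishes_to_orderM d e p q :
  vanishes_to_order d p -> vanishes_to_order e q -> vanishes_to_order (d + e) (p * q).
Proof.
move=> hp hq m md; rewrite mcoeffM big1 // => -[m1 m2] /= /eqP E.
have [/hp ->|dm1] := ltnP (mdeg m1) d; first by rewrite mul0r.
have := congr1 mdeg E; rewrite mdegD => Ed; rewrite hq ?mulr0 //; lia.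
Qed.

Lemma dhomog_vanishes_to_order d p : p \is d.-homog -> vanishes_to_order d p.
Proof. by move=> pd m md; apply: (dhomog_nemf_coeff pd); rewrite /= neq_ltn md. Qed.

Lemma vanishes_to_order_dhomog d p : p \is d.-homog -> vanishes_to_order d.+1 p -> p = 0.
Proof.
move=> pd pv; apply/mpolyP => m; rewrite mcoeff0.
have [/pv //|md] := ltnP (mdeg m) d.+1.
by apply: (dhomog_nemf_coeff pd); rewrite /= neq_ltn md orbT.
Qed.

Lemma vanishes_to_order_span (Q : R -> Prop) d p :
  (forall q, Q q -> vanishes_to_order d q) -> ideal_span Q p -> vanishes_to_order d p.
Proof.
move=> hQ; elim/ideal_span_min => [|p1 p2|a q /hQ hq].
- exact: vanishes_to_order0.
- exact: vanishes_to_orderD.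
- by rewrite -[d]add0n; apply: vanishes_to_orderM.
Qed.

Lemma maxideal_vanishes p : maxideal p -> vanishes_to_order 1 p.
Proof.
apply: vanishes_to_order_span => _ [i ->]; apply: dhomog_vanishes_to_order.
by rewrite dhomogX /= mdeg1.
Qed.

Lemma idealX_vanishes (I : R -> Prop) e s p :
  (forall q, I q -> vanishes_to_order e q) -> idealX I s p -> vanishes_to_order (s * e) p.
Proof.
move=> hI; elim: s p => [//|s IHs] p /=; apply: vanishes_to_order_span.
by move=> _ [a [b [/hI ha /IHs hb ->]]]; rewrite mulSn; apply: vanishes_to_orderM.
Qed.

Lemma mpoly_sub_const (p : R) : exists c, maxideal (p - c%:MP : R).
Proof.
have [||||_ [c ->] hc] := @mpoly_congr_ind _ _ (fun p : R => exists i, p = 'X_i)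
    (fun g => exists c, g = c%:MP) _ _ _ _ p; last by exists c.
- by move=> c; exists c.
- move=> i; exists 0; first by exists 0; rewrite mpolyC0.
  by rewrite subr0; apply: mem_ideal_span; exists i.
- by move=> _ _ [c ->] [c' ->]; exists (c + c'); rewrite mpolyCD.
- by move=> _ _ [c ->] [c' ->]; exists (c * c'); rewrite mpolyCM.
Qed.

End Order.

(** * The special fiber as a quotient of a polynomial ring *)

Section SpecialFiber.
Variables (K : fieldType) (k m e : nat) (g : 'I_m -> {mpoly K[k]}).
Hypothesis g_homog : forall j, g j \is e.-homog.
Local Notation R := {mpoly K[k]}.
Local Notation P := {mpoly K[m]}.
Let I : R -> Prop := ideal_span (fun q => exists j, q = g j).
Local Notation gev := (mmap (@mpolyC k K) g).

Fact rees_gen_subproof j : g j *: 'X \in rees_pred I.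
Proof.
apply/asboolP => s; rewrite coefZ coefX; case: eqP => [->|_]; last first.
  by rewrite mulr0; apply: idealX0.
rewrite mulr1; apply: mem_ideal_span; exists (g j), 1; rewrite mulr1; split=> //.
by apply: mem_ideal_span; exists j.
Qed.
Definition rees_gen j : rees I := Rees (rees_gen_subproof j).

Definition to_rees : {rmorphism P -> rees I} := mmap (in_alg (rees I)) rees_gen.

Lemma val_in_alg_rees c : val (in_alg (rees I) c) = (c%:MP)%:P.
Proof. by rewrite /= -mul_polyC mulr1. Qed.

Let valM : {rmorphism rees I -> {poly R}} := \val.
Let CC : {rmorphism K -> {poly R}} := polyC \o @mpolyC k K.

Lemma to_rees_homog d q : q \is d.-homog -> val (to_rees q) = gev q *: 'X^d.
Proof.
move=> qd; rewrite [LHS](rmorph_mmap (g := valM) _ (f' := CC)); last exact: val_in_alg_rees.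
have gE : valM \o rees_gen =1 (fun j => (g j)%:P * 'X).
  by move=> j /=; rewrite mul_polyC.
rewrite (eq_mmap _ _ gE) (mmap_homog_scale _ _ _ qd) -mul_polyC; congr (_ * _).
by rewrite [RHS](rmorph_mmap (g := polyC) _ (f' := CC)).
Qed.

Let FI : idealr (rees I) := @fiber_ideal K k I.
Let pi_fiber : {rmorphism rees I -> special_fiber I} := \pi_{ideal_quot FI}.
Definition to_fiber : {rmorphism P -> special_fiber I} := pi_fiber \o to_rees.

Lemma to_fiber_scalable : scalable to_fiber.
Proof.
move=> c p; rewrite /to_fiber /= /to_rees /= mmapZ mulr_algl.
exact: (ideal_quotZ FI).
Qed.

Lemma to_rees_sum M q : (msize q <= M)%N ->
  val (to_rees q) = \sum_(d < M) gev (pihomog mdeg d q) *: 'X^d.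
Proof.
move/sum_pihomog => Eq; rewrite {1}Eq (rmorph_sum to_rees) -[LHS]/(valM _) (rmorph_sum valM).
by apply: eq_bigr => d _; apply: to_rees_homog (pihomogP _ _ _).
Qed.

Lemma coef_to_rees q d : (val (to_rees q))`_d = gev (pihomog mdeg d q).
Proof.
pose M := maxn (msize q) d.+1; have dM : (d < M)%N by rewrite leq_max ltnSn orbT.
rewrite (@to_rees_sum M) ?leq_maxl // coef_sum (bigD1 (Ordinal dM)) //=.
rewrite coefZ coefXn eqxx mulr1 big1 ?addr0 // => i; rewrite -val_eqE /= => id.
by rewrite coefZ coefXn eq_sym (negPf id) mulr0.
Qed.

(** Elements of I^d have order at least d e, and the factor from the maximal ideal adds one. *)
Lemma fiber_ideal_vanishes y d :
  y \in FI -> vanishes_to_order (d * e).+1 (val y)`_d.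
Proof.
move/asboolP; elim/ideal_span_min => [|y1 y2 h1 h2|b x [p pm /= ->]].
- by rewrite coef0; apply: vanishes_to_order0.
- by rewrite coefD; apply: vanishes_to_orderD.
rewrite coefMC -addn1; apply: vanishes_to_orderM; last exact: maxideal_vanishes.
have /asboolP/(_ d) := valP b; apply: idealX_vanishes.
by move=> r; apply: vanishes_to_order_span => _ [j ->]; apply: dhomog_vanishes_to_order.
Qed.

(** The t^d-coefficient of [to_rees q] is a form of degree d e; if it vanishes to order greater than
    d e, it is 0. *)
Lemma to_fiber_eq0 q : to_fiber q = 0 <-> forall d, gev (pihomog mdeg d q) = 0.
Proof.
apply: (iff_trans (ideal_quot_eq0 FI _)); split=> [/fiber_ideal_vanishes h d|q0].
  have := h d; rewrite coef_to_rees; apply: vanishes_to_order_dhomog.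
  by apply: dhomog_mmap => //; apply: pihomogP.
rewrite (_ : to_rees q = 0) ?idealr0 //; apply: val_inj.
by apply/polyP => d; rewrite coef_to_rees q0 coef0.
Qed.

(** The class of p t^d in the fiber is the value of a form of degree d in the generators; [y]
    witnesses that p t^d lies in the Rees algebra. *)
Let lifts d p := exists (y : rees I) q,
  [/\ val y = p *: 'X^d, q \is d.-homog & pi_fiber y = to_fiber q].

Lemma lifts0 d : lifts d 0.
Proof. by exists 0, 0; rewrite scale0r dhomog0 !rmorph0. Qed.

Lemma liftsD d p1 p2 : lifts d p1 -> lifts d p2 -> lifts d (p1 + p2).
Proof.
move=> [y1 [q1 [v1 h1 E1]]] [y2 [q2 [v2 h2 E2]]]; exists (y1 + y2), (q1 + q2).
by rewrite rmorphD /= v1 v2 scalerDl !rmorphD /= E1 E2 dhomogD.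
Qed.

Lemma liftsM d1 d2 p1 p2 : lifts d1 p1 -> lifts d2 p2 -> lifts (d1 + d2) (p1 * p2).
Proof.
move=> [y1 [q1 [v1 h1 E1]]] [y2 [q2 [v2 h2 E2]]]; exists (y1 * y2), (q1 * q2).
rewrite rmorphM /= v1 v2 !rmorphM /= E1 E2 dhomogM //; split=> //.
by rewrite -!mul_polyC polyCM exprD mulrACA.
Qed.

(** Modulo the maximal ideal, [p] is a constant. *)
Lemma lifts_const p : lifts 0 p.
Proof.
have polyC_rees q : q%:P \in rees_pred I.
  by apply/asboolP => -[|s] //; rewrite coefC; apply: idealX0.
have [c hc] := mpoly_sub_const p; exists (Rees (polyC_rees p)), c%:MP.
split; first by rewrite expr0 alg_polyC.
  by rewrite -[c%:MP]mulr1 mul_mpolyC; apply/dhomogZ/dhomog1.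
apply/eqP; rewrite -subr_eq0 -rmorphB; apply/eqP/ideal_quot_eq0.
apply/asboolP/mem_ideal_span; exists (p - c%:MP) => //.
rewrite [LHS](rmorphB valM) polyCB; congr (_ - _).
by rewrite [to_rees _]mmapC; apply: val_in_alg_rees.
Qed.

(** Lifting proceeds factor by factor: ring coefficients in degree 0, and each g_j to y_j in degree
    1. *)
Lemma idealX_lifts d p : idealX I d p -> lifts d p.
Proof.
elim: d p => [|d IHd] p /=; first by move=> _; apply: lifts_const.
elim/ideal_span_min => [|*|a _ [u [v [Iu /IHd hv ->]]]].
- exact: lifts0.
- exact: liftsD.
rewrite -[d.+1]add1n mulrA; apply: liftsM hv; rewrite -[1%N]add0n.
apply: liftsM; first exact: lifts_const.
elim/ideal_span_min: u / Iu => [|*|b _ [j ->]].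
- exact: lifts0.
- exact: liftsD.
rewrite -[1%N]add0n; apply: liftsM; first exact: lifts_const.
by exists (rees_gen j), 'X_j; rewrite dhomogX /= mdeg1 /to_fiber /= mmapXU.
Qed.

Lemma special_fiber_degE d x :
  special_fiber_deg d x <-> exists2 q, q \is d.-homog & x = to_fiber q.
Proof.
split=> [[y [[p vy] ->]]|[q qd ->]]; last first.
  by exists (to_rees q); split=> //; exists (gev q); apply: to_rees_homog.
have : idealX I d p.
  have -> : p = (val y)`_d by rewrite vy coefZ coefXn eqxx mulr1.
  by have /asboolP := valP y; apply.
move=> /idealX_lifts[y' [q [vy' qd E]]]; exists q => //; rewrite -E.
by congr (\pi _); apply: val_inj; rewrite vy vy'.
Qed.

Lemma to_fiber_surj x : exists q, x = to_fiber q.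
Proof.
have [y ->] := ideal_quot_surj x.
have h (i : 'I_(size (val y))) :
    {z : rees I * P | val z.1 = (val y)`_i *: 'X^i & pi_fiber z.1 = to_fiber z.2}.
  apply: cid2; have /asboolP/(_ i)/idealX_lifts[z [q [vz _ E]]] := valP y.
  by exists (z, q).
exists (\sum_i (s2val (h i)).2); rewrite rmorph_sum.
have Ey : y = \sum_i (s2val (h i)).1.
  apply: val_inj; rewrite [RHS](rmorph_sum valM) -[LHS]coefK poly_def.
  by apply: eq_bigr => i _; rewrite [RHS](s2valP (h i)).
apply: etrans (congr1 pi_fiber Ey) _.
by rewrite rmorph_sum; apply: eq_bigr => i _; apply: (s2valP' (h i)).
Qed.

End SpecialFiber.

(** * The two isomorphisms *)

Section SubalgebraPresentation.
Variables (K : fieldType) (k m : nat) (h : 'I_m -> ratfun K k).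

Fact subalg_gen_subproof j : h j \in subalg_pred h.
Proof. by apply/asboolP; exists 'X_j; rewrite mmapXU. Qed.
Definition subalg_gen j : subalg h := Subalg (subalg_gen_subproof j).

Definition to_subalg : {rmorphism {mpoly K[m]} -> subalg h} :=
  mmap (in_alg (subalg h)) subalg_gen.

Lemma val_to_subalg p : subalg_val (to_subalg p) = mmap (in_alg (ratfun K k)) h p.
Proof.
pose valM : {rmorphism subalg h -> ratfun K k} := \val.
exact: (rmorph_mmap (g := valM) _ (f' := in_alg (ratfun K k))).
Qed.

Lemma to_subalg_scalable : scalable to_subalg.
Proof. by move=> c p; rewrite /to_subalg /= mmapZ mulr_algl. Qed.

Lemma to_subalg_surj x : exists p, x = to_subalg p.
Proof.
have /asboolP[p xp] := valP x; exists p; apply: val_inj.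
by rewrite [RHS]val_to_subalg.
Qed.

Lemma to_subalg_eq0 p : to_subalg p = 0 <-> mmap (in_alg (ratfun K k)) h p = 0.
Proof.
rewrite -val_to_subalg; split=> [->|p0]; first exact: (rmorph0 \val).
by apply: val_inj; rewrite [LHS]p0; apply/esym/(rmorph0 \val).
Qed.

End SubalgebraPresentation.

Lemma ideal_spanS (S : comNzRingType) (P Q : S -> Prop) :
  (forall x, P x -> Q x) -> forall x, ideal_span P x -> ideal_span Q x.
Proof. by move=> PQ x [s [hs ->]]; exists s; split=> // c /hs/PQ. Qed.

Section Arrangement.
Variables (K : fieldType) (k n : nat) (A : arrangement K k n).
Local Notation L := (form_prod A setT).

Lemma form_prod_homog (D : {set 'I_n}) : form_prod A D \is #|D|.-homog.
Proof.
rewrite /form_prod -sum1_card; elim/big_rec2: _ => [|i d p _ pd]; first exact: dhomog1.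
by apply: dhomogM => //; apply: form_homog.
Qed.

Lemma form_prod_neq0 (D : {set 'I_n}) : form_prod A D != 0.
Proof. by apply/prodf_neq0 => i _; apply: form_neq0. Qed.

Lemma form_prod_setT_homog : L \is n.-homog.
Proof. by rewrite -[X in X.-homog](card_ord n) -cardsT form_prod_homog. Qed.

(** This brings the generators over one common denominator, as the comparison with g_j t
    requires. *)
Lemma form_prodV D :
  to_ratfun (form_prod A D) / to_ratfun L = (to_ratfun (form_prod A (~: D)))^-1.
Proof.
have -> : L = form_prod A D * form_prod A (~: D).
  rewrite /form_prod (bigID (mem D)) /=; congr (_ * _); apply: eq_bigl => i.
    by rewrite inE.
  by rewrite !inE.
rewrite rmorphM invfM mulrA mulfV ?mul1r // to_ratfun_eq0; exact: form_prod_neq0.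
Qed.

Lemma recip_algebra_iso m s (S : 'I_m -> {set 'I_n}) :
  (forall j, #|S j| = s) -> (s < n)%N ->
  graded_iso (@recip_algebra_deg K k n A m s S) (@special_fiber_deg K k (prod_ideal A S)).
Proof.
move=> cardS sn.
have gs j : form_prod A (S j) \is s.-homog by rewrite -(cardS j) form_prod_homog.
pose h j := (to_ratfun (form_prod A (~: S j)))^-1.
pose ev : {mpoly K[m]} -> ratfun K k := mmap (in_alg (ratfun K k)) h.
have hE p : ev p = mmap (in_alg (ratfun K k))
    (fun j => to_ratfun (form_prod A (S j)) / to_ratfun L) p.
  by apply: eq_mmap => j; rewrite form_prodV.
apply: (graded_iso_of_presentations (f := to_subalg h)
  (g := to_fiber (fun j => form_prod A (S j)))).
- exact: to_subalg_scalable.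
- exact: to_fiber_scalable.
- exact: to_subalg_surj.
- exact: to_fiber_surj.
- move=> p; apply: iff_trans (to_subalg_eq0 h p) _; rewrite -/(ev p) hE.
  apply: iff_trans (iff_sym (to_fiber_eq0 gs p)).
  exact: (mmap_quotient_eq0 gs form_prod_setT_homog (form_prod_neq0 _) sn).
- move=> d x; rewrite /recip_algebra_deg; split=> [xd|[p pd ->]]; last first.
    rewrite val_to_subalg -/(ev p) hE.
    exact: (ratfun_homog_mmap gs form_prod_setT_homog (form_prod_neq0 _) sn).
  (* A homogeneous element is the image of the degree-d component of any of its preimages. *)
  have [p xp] := to_subalg_surj x; exists (pihomog mdeg d p); first exact: pihomogP.
  move: xd; rewrite xp val_to_subalg -/(ev p) hE => pd; apply: val_inj.
  rewrite /= !val_to_subalg -!/(ev _) !hE.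
  exact: (ratfun_homog_mmapP gs form_prod_setT_homog (form_prod_neq0 _) sn).
- exact: special_fiber_degE.
Qed.

Let cofactor i := \prod_(j | j != i) A j.

Lemma cofactorE i : cofactor i = form_prod A (~: [set i]).
Proof. by apply: eq_bigl => j; rewrite !inE. Qed.

Lemma cofactor_homog i : cofactor i \is n.-1.-homog.
Proof.
by rewrite cofactorE -[X in X.-1](card_ord n) -(cardsC1 i); apply: form_prod_homog.
Qed.

Lemma recip_eval_cofactor q : recip_eval A q =
  mmap (in_alg (ratfun K k)) (fun i => to_ratfun (cofactor i) / to_ratfun L) q.
Proof.
apply: eq_mmap => i; rewrite cofactorE form_prodV setCK.
by rewrite /form_prod big_set1.
Qed.

Lemma recip_eval_eq0 q : recip_eval A q = 0 <->
  forall d, mmap (@mpolyC k K) cofactor (pihomog mdeg d q) = 0.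
Proof.
(* For n = 0 the inequality n.-1 < n fails, but then every polynomial is constant. *)
rewrite recip_eval_cofactor; have [n0|n_gt0] := posnP n; last first.
  apply: (mmap_quotient_eq0 cofactor_homog form_prod_setT_homog (form_prod_neq0 _)).
  by rewrite prednK.
have q0 : q \is 0.-homog by apply: nvar0_homog_eq.
rewrite (mmap_quotient_homog _ _ q0) expr0 rmorph1 divr1.
split=> [/eqP|/(_ 0%N)]; last by rewrite pihomog_dE // => ->; rewrite rmorph0.
rewrite to_ratfun_eq0 => /eqP qc d; have [->|d0] := eqVneq d 0%N.
  by rewrite pihomog_dE.
by rewrite (@pihomog_ne0 _ _ _ 0) ?rmorph0 // eq_sym.
Qed.

(** Completeness of the relations gives the converse; relations of deleted forms do not occur, as
    the forms of [A] are nonzero. *)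
Lemma orlik_terao_idealE q : orlik_terao_ideal A q <-> recip_eval A q = 0.
Proof.
split=> [/asboolP h|h].
  apply: recip_relation_eval0; apply: ideal_spanS h => b [D [c [dep ->]]]; right; exists D, c.
  by split=> // i _; apply: form_neq0.
apply/asboolP; have := recip_relations_complete (form_homog A) h; apply: ideal_spanS.
move=> b [[i Ai]|[D [c [_ dep ->]]]]; last by exists D, c.
by have := form_neq0 A i; rewrite Ai eqxx.
Qed.

Lemma orlik_terao_iso :
  graded_iso (@orlik_terao_deg K k n A) (@special_fiber_deg K k (cofactor_ideal A)).
Proof.
pose OTI : idealr {mpoly K[n]} := @orlik_terao_ideal K k n A.
pose to_OT : {rmorphism {mpoly K[n]} -> orlik_terao A} := \pi_{ideal_quot OTI}.
apply: (graded_iso_of_presentations (f := to_OT) (g := to_fiber cofactor)).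
- exact: ideal_quotZ.
- exact: to_fiber_scalable.
- exact: ideal_quot_surj.
- exact: to_fiber_surj.
- move=> p; apply: iff_trans (ideal_quot_eq0 OTI p) _.
  apply: iff_trans (orlik_terao_idealE p) _; apply: iff_trans (recip_eval_eq0 p) _.
  exact: iff_sym (to_fiber_eq0 cofactor_homog p).
- by move=> d x; split=> [[q [qd ->]]|[q qd ->]]; exists q.
- exact: special_fiber_degE.
Qed.

End Arrangement.

Theorem theorem2p4 (K : fieldType) (k n : nat) (A : arrangement K k n) :
  (forall (m s : nat) (S : 'I_m -> {set 'I_n}),
      (forall j, #|S j| = s) -> (s < n)%N ->
      graded_iso (@recip_algebra_deg K k n A m s S)
        (@special_fiber_deg K k (prod_ideal A S)))
  /\ graded_iso (@orlik_terao_deg K k n A)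
       (@special_fiber_deg K k (cofactor_ideal A)).
Proof.
split=> [m s S|]; [exact: recip_algebra_iso | exact: orlik_terao_iso].
Qed.
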